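(* Let $(X,L)$ be a measurable bundle of $C^*$-algebras over $\Omega$ with lifting $p$ and vector-valued lifting $\ell$ (with the standing assumptions in the context). Let $T:L^\infty(\Omega,X)\to L^\infty(\Omega,X)$ be an $L^\infty(\Omega)$-linear Markov operator and $\varphi:L^\infty(\Omega,X)\to L^\infty(\Omega)$ an $L^\infty(\Omega)$-valued $L^\infty(\Omega)$-linear state. For each $\omega\in\Omega$ let $T_\omega:X(\omega)\to X(\omega)$ and $\varphi_\omega:X(\omega)\to\mathbb C$ be the continuous linear maps determined by $$T_\omega(\ell(x)(\omega))=\ell(Tx)(\omega),\qquad \varphi_\omega(\ell(x)(\omega))=p(\varphi(x))(\omega),\qquad x\in L^\infty(\Omega,X).$$ If $(L^\infty(\Omega,X),T,\varphi)$ is $L^\infty$-uniquely ergodic with respect to $\varphi$, then the collection $\{(X(\omega),T_\omega,\varphi_\omega):\omega\in\Omega\}$ is uniformly uniquely ergodic with respect to $\{\varphi_\omega\}$.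
   Context: $(\Omega,\Sigma,\lambda)$ is a measure space with finite complete measure $\lambda$; $L_0=L_0(\Omega)$ is the algebra of a.e.-equivalence classes of measurable complex functions, with the a.e. order on real elements and unit $\mathbf 1$. $\mathcal L^\infty(\Omega)$ is the set of bounded measurable functions on $\Omega$ (defined everywhere, sup norm), and $L^\infty(\Omega)=\{f\in L_0:|f|\le\alpha\mathbf 1\text{ for some }\alpha>0\}$ with norm $\|f\|_{L^\infty(\Omega)}=\inf\{\alpha>0:|f|\le\alpha\mathbf 1\}$. Measurable bundle of $C^*$-algebras: $X$ assigns to each $\omega\in\Omega$ a $C^*$-algebra $X(\omega)\ne\{0\}$. A section is a function $u$ defined a.e. on $\Omega$ with $u(\omega)\in X(\omega)$ on its domain. $(X,L)$, with $L$ a set of sections, is a measurable bundle of $C^*$-algebras if: $L$ is closed under complex linear combinations, products and involution (pointwise on intersections of domains); for each $c\in L$ the function $\omega\mapsto\|c(\omega)\|_{X(\omega)}$ is measurable; and for every $\omega$ the set $\{c(\omega):c\in L,\ \omega\in\mathrm{dom}(c)\}$ is dense in $X(\omega)$. A section $s$ is simple if $s(\omega)=\sum_{i=1}^n\chi_{A_i}(\omega)c_i(\omega)$ for a.e. $\omega$, $c_i\in L$, $A_i\in\Sigma$; a section is measurable if it is an a.e. pointwise norm limit of a sequence of simple sections. $M(\Omega,X)$ is the set of measurable sections; $L_0(\Omega,X)$ is its quotient by a.e. equality; $\widehat u$ is the class of $u$; $\|\widehat u\|\in L_0$ is the class of $\omega\mapsto\|u(\omega)\|_{X(\omega)}$.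 $L^\infty(\Omega,X)=\{\widehat u\in L_0(\Omega,X):\|\widehat u\|\in L^\infty(\Omega)\}$ with the real-valued norm $\|\widehat u\|_\infty=\big\|\,\|\widehat u\|\,\big\|_{L^\infty(\Omega)}$ (a $C^*$-algebra and an $L^\infty(\Omega)$-module under pointwise operations), and $\mathcal L^\infty(\Omega,X)=\{u\in M(\Omega,X):\|u(\cdot)\|_{X(\cdot)}\in\mathcal L^\infty(\Omega)\}$. Lifting: $p:L^\infty(\Omega)\to\mathcal L^\infty(\Omega)$ is a (unital) algebra homomorphism with $p(f)\in f$, $\mathrm{dom}\,p(f)=\Omega$ and $\|p(f)\|_{\mathcal L^\infty(\Omega)}=\|f\|_{L^\infty(\Omega)}$. The vector-valued lifting associated with $p$ is a map $\ell:L^\infty(\Omega,X)\to\mathcal L^\infty(\Omega,X)$ such that $\ell(u)\in u$, $\mathrm{dom}\,\ell(u)=\Omega$, $\|\ell(u)(\omega)\|_{X(\omega)}=p(\|u\|)(\omega)$, $\ell(u+v)=\ell(u)+\ell(v)$, $\ell(fu)=p(f)\ell(u)$ for $f\in L^\infty(\Omega)$, $\ell(u^* )=\ell(u)^*$, $\ell(uv)=\ell(u)\ell(v)$, and $\{\ell(u)(\omega):u\in L^\infty(\Omega,X)\}$ is dense in $X(\omega)$ for every $\omega$. Standing assumptions: such $p$ and $\ell$ are fixed, and $L_0(\Omega,X)$ has a unit $e$ with $\|e\|=\mathbf 1$; $e(\omega):=\ell(e)(\omega)$ is then the unit of $X(\omega)$. An $L^\infty(\Omega)$-linear Markov operator $T$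 on $L^\infty(\Omega,X)$ is an $L^\infty(\Omega)$-linear map that is positive (maps elements of the form $yy^*$ to elements of this form) with $Te=e$. An $L^\infty(\Omega)$-valued state $\varphi$ is an $L^\infty(\Omega)$-linear map $L^\infty(\Omega,X)\to L^\infty(\Omega)$ with $\varphi(yy^* )\ge0$ for all $y$ and $\varphi(e)=\mathbf 1$. $(L^\infty(\Omega,X),T,\varphi)$ is $L^\infty$-uniquely ergodic with respect to $\varphi$ if $\frac1n\sum_{k=0}^{n-1}T^k(x)\to\varphi(x)e$ in the norm $\|\cdot\|_\infty$ for every $x\in L^\infty(\Omega,X)$. The collection $\{T_\omega\}$ is uniformly uniquely ergodic with respect to $\{\varphi_\omega\}$ if, for every $x\in L^\infty(\Omega,X)$, writing $x(\omega)=\ell(x)(\omega)$, $$\lim_{n\to\infty}\sup_{\omega\in\Omega}\Big\|\frac1n\sum_{k=0}^{n-1}T_\omega^k(x(\omega))-\varphi_\omega(x(\omega))e(\omega)\Big\|_{X(\omega)}=0.$$ *)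

(* Defs.v *)
From HB Require Import structures.
From mathcomp Require Import all_boot all_order all_algebra generic_quotient.
From mathcomp Require Import complex.
From mathcomp Require Import all_classical all_reals all_analysis.

Set Implicit Arguments.
Unset Strict Implicit.
Unset Printing Implicit Defensive.
Import Order.TTheory GRing.Theory Num.Theory.
Import numFieldNormedType.Exports.
Local Open Scope classical_set_scope.
Local Open Scope ring_scope.
Local Open Scope complex_scope.
Local Open Scope quotient_scope.

(* C*-algebras are not assumed unital, hence no ring structure: the product is
   a separate operation on a complete complex normed module. Norms take their
   values in the nonnegative reals of [R[i]]. *)

HB.mixin Record CompleteNormedModule_isCstarAlgebra (R : realType) A
    of CompleteNormedModule R[i] A := {
  csmul : A -> A -> A ;
  csstar : A -> A ;
  csmulA : associative csmul ;
  csmulDl : left_distributive csmul +%R ;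
  csmulDr : right_distributive csmul +%R ;
  csmulZl : forall (a : R[i]) (x y : A), csmul (a *: x) y = a *: csmul x y ;
  csmulZr : forall (a : R[i]) (x y : A), csmul x (a *: y) = a *: csmul x y ;
  csstarK : involutive csstar ;
  csstarD : forall x y : A, csstar (x + y) = csstar x + csstar y ;
  csstarZ : forall (a : R[i]) (x : A), csstar (a *: x) = a^*%R *: csstar x ;
  csstarM : forall x y : A, csstar (csmul x y) = csmul (csstar y) (csstar x) ;
  csnormM : forall x y : A, `|csmul x y| <= `|x| * `|y| ;
  csnorm_star : forall x : A, `|csmul (csstar x) x| = `|x| ^+ 2
}.

#[short(type="cstarAlgType")]
HB.structure Definition CstarAlgebra (R : realType) :=
  {A of CompleteNormedModule R[i] A & CompleteNormedModule_isCstarAlgebra R A}.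

Section AeSections.
Context d (Omega : measurableType d) (R : realType).
Variable mu : {measure set Omega -> \bar R}.
Implicit Types U V W : Omega -> Type.

(* A partial function, [None] meaning "undefined at this point". *)
Record aesec V := AeSec {
  aeval :> forall w, option (V w) ;
  aeval_ae : {ae mu, forall w, aeval w <> None} }.

HB.instance Definition _ V := gen_eqMixin (aesec V).
HB.instance Definition _ V := gen_choiceMixin (aesec V).

Definition aedom V (u : aesec V) : set Omega := [set w | u w <> None].

Definition aetotal V (f : forall w, V w) : aesec V.
Proof. by exists (fun w => Some (f w)); apply: aeW. Defined.

Definition aemap V W (f : forall w, V w -> W w) (u : aesec V) : aesec W.
Proof.
exists (fun w => omap (f w) (u w)).
by apply: filterS (aeval_ae u) => w; case: (u w).
Defined.

(* Pointwise on the intersection of the domains. *)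
Definition aemap2 U V W (f : forall w, U w -> V w -> W w)
  (u : aesec U) (v : aesec V) : aesec W.
Proof.
exists (fun w => obind (fun a => omap (f w a) (v w)) (u w)).
by apply: filterS2 (aeval_ae u) (aeval_ae v) => w; case: (u w); case: (v w).
Defined.

Definition aeeq V (u v : aesec V) : bool := `[< {ae mu, forall w, u w = v w} >].

Lemma aeeq_refl V : reflexive (@aeeq V).
Proof. by move=> u; apply/asboolP; apply: aeW. Qed.

Lemma aeeq_sym V : symmetric (@aeeq V).
Proof. by move=> u v; apply: asbool_equiv_eq; split; apply: filterS. Qed.

Lemma aeeq_trans V : transitive (@aeeq V).
Proof.
move=> v u w /asboolP uv /asboolP vw; apply/asboolP.
by apply: filterS2 uv vw => x -> ->.
Qed.

Canonical aeeq_equiv V :=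
  EquivRel (@aeeq V) (@aeeq_refl V) (@aeeq_sym V) (@aeeq_trans V).

Definition aeclass V : Type := {eq_quot (@aeeq_equiv V)}.

HB.instance Definition _ V := Choice.on (aeclass V).
HB.instance Definition _ V := EqQuotient.on (aeclass V).

Definition aecl V (u : aesec V) : aeclass V := \pi_(aeclass V) u.

Definition aeclmap V W (f : forall w, V w -> W w) (u : aeclass V) : aeclass W :=
  aecl (aemap f (repr u)).

Definition aeclmap2 U V W (f : forall w, U w -> V w -> W w)
  (u : aeclass U) (v : aeclass V) : aeclass W :=
  aecl (aemap2 f (repr u) (repr v)).

Lemma aeclP V (u v : aesec V) :
  aecl u = aecl v <-> {ae mu, forall w, u w = v w}.
Proof.
split=> [/eqmodP/asboolP//|uv].
by apply/eqmodP/asboolP.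
Qed.

Lemma repr_aecl V (u : aesec V) : {ae mu, forall w, repr (aecl u) w = u w}.
Proof. by apply/aeclP; rewrite /aecl reprK. Qed.

Lemma aeclK V (u : aeclass V) : aecl (repr u) = u.
Proof. by rewrite /aecl reprK. Qed.

Lemma aeclmapE V W (f : forall w, V w -> W w) (u : aesec V) :
  aeclmap f (aecl u) = aecl (aemap f u).
Proof. by apply/aeclP; apply: filterS (repr_aecl u) => w /= ->. Qed.

Lemma aeclmap2E U V W (f : forall w, U w -> V w -> W w) u v :
  aeclmap2 f (aecl u) (aecl v) = aecl (aemap2 f u v).
Proof.
by apply/aeclP; apply: filterS2 (repr_aecl u) (repr_aecl v) => w /= -> ->.
Qed.

End AeSections.

Section AeLmodule.
Context d (Omega : measurableType d) (R : realType).
Variable mu : {measure set Omega -> \bar R}.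
Variable V : Omega -> lmodType R[i].
Local Notation S := (aeclass mu V).

Definition aecl0 : S := aecl (aetotal mu (fun w => 0 : V w)).
Definition aecl_opp : S -> S := aeclmap (fun w (x : V w) => - x).
Definition aecl_add : S -> S -> S := aeclmap2 (fun w (x y : V w) => x + y).
Definition aecl_scale (a : R[i]) : S -> S := aeclmap (fun w (x : V w) => a *: x).

Lemma aecl_addA : associative aecl_add.
Proof.
move=> u v w; rewrite -[u]aeclK -[v]aeclK -[w]aeclK /aecl_add !aeclmap2E.
apply/aeclP/aeW => x /=.
by case: (repr u x) (repr v x) (repr w x) => [?|] [?|] [?|] //=; rewrite addrA.
Qed.

Lemma aecl_addC : commutative aecl_add.
Proof.
move=> u v; rewrite -[u]aeclK -[v]aeclK /aecl_add !aeclmap2E.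
apply/aeclP/aeW => x /=.
by case: (repr u x) (repr v x) => [?|] [?|] //=; rewrite addrC.
Qed.

Lemma aecl_add0 : left_id aecl0 aecl_add.
Proof.
move=> u; rewrite -[u]aeclK /aecl_add !aeclmap2E.
by apply/aeclP/aeW => x /=; case: (repr u x) => [?|] //=; rewrite add0r.
Qed.

Lemma aecl_addN : left_inverse aecl0 aecl_opp aecl_add.
Proof.
move=> u; rewrite -[u]aeclK /aecl_add /aecl_opp aeclmapE !aeclmap2E.
apply/aeclP; apply: filterS (aeval_ae (repr u)) => x /=.
by case: (repr u x) => [?|] //=; rewrite addNr.
Qed.

HB.instance Definition _ :=
  GRing.isZmodule.Build S aecl_addA aecl_addC aecl_add0 aecl_addN.

Lemma aecl_scaleA a b u :
  aecl_scale a (aecl_scale b u) = aecl_scale (a * b) u.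
Proof.
rewrite -[u]aeclK /aecl_scale !aeclmapE.
by apply/aeclP/aeW => x /=; case: (repr u x) => [?|] //=; rewrite scalerA.
Qed.

Lemma aecl_scale1 : left_id 1 aecl_scale.
Proof.
move=> u; rewrite -[u]aeclK /aecl_scale !aeclmapE.
by apply/aeclP/aeW => x /=; case: (repr u x) => [?|] //=; rewrite scale1r.
Qed.

Lemma aecl_scaleDr : right_distributive aecl_scale +%R.
Proof.
move=> a u v; rewrite -[u]aeclK -[v]aeclK /+%R /= /aecl_add /aecl_scale.
rewrite aeclmap2E !aeclmapE aeclmap2E; apply/aeclP/aeW => x /=.
by case: (repr u x) (repr v x) => [?|] [?|] //=; rewrite scalerDr.
Qed.

Lemma aecl_scaleDl u : {morph aecl_scale^~ u : a b / a + b}.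
Proof.
move=> a b; rewrite -[u]aeclK [RHS]/+%R /= /aecl_add /aecl_scale.
rewrite !aeclmapE aeclmap2E; apply/aeclP/aeW => x /=.
by case: (repr u x) => [?|] //=; rewrite scalerDl.
Qed.

HB.instance Definition _ := GRing.Zmodule_isLmodule.Build R[i] S
  aecl_scaleA aecl_scale1 aecl_scaleDr aecl_scaleDl.

End AeLmodule.

Section Scalars.
Context d (Omega : measurableType d) (R : realType).
Variable mu : {measure set Omega -> \bar R}.

Definition scalar_fam (w : Omega) : normedModType R[i] := R[i]^o.

Local Notation fsec := (aesec mu scalar_fam).
Local Notation fcl := (aeclass mu scalar_fam).

(* In this and the following definitions the value [odflt 0] never matters: it
   is used on the domain only, or up to negligible sets. *)
Definition cmeasurable (f : fsec) : Prop :=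
  measurable_fun (aedom f) (fun w => complex.Re (odflt 0 (f w) : R[i])) /\
  measurable_fun (aedom f) (fun w => complex.Im (odflt 0 (f w) : R[i])).

Definition L0 : set fcl := [set f | exists2 u, cmeasurable u & aecl u = f].

Definition aeone : fcl := aecl (aetotal mu (fun w => 1 : R[i]^o)).

(* On [R[i]], [x <= y] means that [y - x] is a nonnegative real. *)
Definition aele (f g : fcl) : Prop :=
  {ae mu, forall w, (odflt 0 (repr f w) : R[i]) <= odflt 0 (repr g w)}.

Definition aenorm (V : Omega -> normedModType R[i]) : aeclass mu V -> fcl :=
  aeclmap (W := scalar_fam) (fun w (x : V w) => `|x|).

(* Multiplication of a section by a function; on scalar functions themselves
   this is the product of L_0. *)
Definition aemulf (V : Omega -> lmodType R[i]) :
  fcl -> aeclass mu V -> aeclass mu V :=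
  aeclmap2 (fun w (a : R[i]) (x : V w) => a *: x).

Definition Linf : set fcl :=
  [set f | L0 f /\ exists2 a : R, 0 < a & aele (aenorm f) (a%:C *: aeone)].

(* The real infimum is the true one for [f] in [Linf] only. *)
Definition Linf_norm (f : fcl) : R :=
  inf [set a : R | 0 < a /\ aele (aenorm f) (a%:C *: aeone)].

(* Everywhere defined bounded measurable functions. *)
Definition cLinf : set (Omega -> R[i]) :=
  [set f | cmeasurable (aetotal mu (f : forall w, scalar_fam w)) /\
           exists M : R, forall w, `|f w| <= M%:C].

Definition cLinf_norm (f : Omega -> R[i]) : R :=
  sup (range (fun w => complex.Re `|f w|)).

Record is_lifting (p : fcl -> Omega -> R[i]) : Prop := IsLifting {
  lift_cLinf : forall f, Linf f -> cLinf (p f) ;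
  lift_class : forall f, Linf f ->
    aecl (aetotal mu (p f : forall w, scalar_fam w)) = f ;
  lift_norm : forall f, Linf f -> cLinf_norm (p f) = Linf_norm f ;
  liftD : forall f g, Linf f -> Linf g ->
    p (f + g) = (fun w => p f w + p g w) ;
  liftZ : forall (a : R[i]) f, Linf f -> p (a *: f) = (fun w => a * p f w) ;
  liftM : forall f g, Linf f -> Linf g ->
    p (aemulf f g) = (fun w => p f w * p g w) ;
  lift1 : p aeone = (fun=> 1) }.

End Scalars.

Section Bundles.
Context d (Omega : measurableType d) (R : realType).
Variable mu : {measure set Omega -> \bar R}.
Variable X : Omega -> cstarAlgType R.

Local Notation fcl := (aeclass mu (scalar_fam R)).
Local Notation sec := (aesec mu X).
Local Notation cl := (aeclass mu X).

Record is_bundle (L : set sec) : Prop := IsBundle {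
  bundle_neq0 : forall w, exists x : X w, x <> 0 ;
  bundle_lin : forall (a b : R[i]) u v, L u -> L v ->
    L (aemap2 (fun w (x y : X w) => a *: x + b *: y) u v) ;
  bundle_mul : forall u v, L u -> L v ->
    L (aemap2 (fun w (x y : X w) => csmul x y) u v) ;
  bundle_star : forall u, L u -> L (aemap (fun w (x : X w) => csstar x) u) ;
  bundle_norm : forall u, L u ->
    cmeasurable (aemap (W := scalar_fam R)
      (fun w (x : X w) => `|x|) u) ;
  bundle_dense : forall w,
    dense [set x : X w | exists2 c, L c & c w = Some x] }.

Definition simple_section (L : set sec) (s : sec) : Prop :=
  exists (n : nat) (A : 'I_n -> set Omega) (c : 'I_n -> sec),
    (forall i, d.-measurable (A i) /\ L (c i)) /\
    {ae mu, forall w,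
      s w = Some (\sum_(i < n) (\1_(A i) w : R[i]) *: odflt 0 (c i w))}.

Definition measurable_section (L : set sec) : set sec :=
  [set u | exists2 s : nat -> sec, (forall n, simple_section L (s n)) &
    {ae mu, forall w, odflt 0 (s n w) @[n --> \oo] --> odflt 0 (u w)}].

Definition L0X (L : set sec) : set cl :=
  [set u | exists2 v, measurable_section L v & aecl v = u].

Definition aeclmul : cl -> cl -> cl :=
  aeclmap2 (fun w (x y : X w) => csmul x y).

Definition aeclstar : cl -> cl := aeclmap (fun w (x : X w) => csstar x).

Definition LinfX (L : set sec) : set cl :=
  [set u | L0X L u /\ Linf (aenorm u)].

Definition LinfX_norm (u : cl) : R := Linf_norm (aenorm u).

Definition cLinfX (L : set sec) : set (forall w, X w) :=
  [set f | measurable_section L (aetotal mu f) /\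
           cLinf mu (fun w => `|f w|)].

Record is_vlifting (L : set sec) (p : fcl -> Omega -> R[i])
    (l : cl -> forall w, X w) : Prop := IsVLifting {
  vlift_cLinf : forall u, LinfX L u -> cLinfX L (l u) ;
  vlift_class : forall u, LinfX L u -> aecl (aetotal mu (l u)) = u ;
  vlift_norm : forall u w, LinfX L u -> `|l u w| = p (aenorm u) w ;
  vliftD : forall u v w, LinfX L u -> LinfX L v -> l (u + v) w = l u w + l v w ;
  vliftZ : forall f u w, Linf f -> LinfX L u ->
    l (aemulf f u) w = p f w *: l u w ;
  vlift_star : forall u w, LinfX L u -> l (aeclstar u) w = csstar (l u w) ;
  vliftM : forall u v w, LinfX L u -> LinfX L v ->
    l (aeclmul u v) w = csmul (l u w) (l v w) ;
  vlift_dense : forall w, dense [set x : X w | exists2 u, LinfX L u & l u w = x] }.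

Record is_L0X_unit (L : set sec) (e : cl) : Prop := IsL0XUnit {
  unit_L0X : L0X L e ;
  unit_mull : forall u, L0X L u -> aeclmul e u = u ;
  unit_mulr : forall u, L0X L u -> aeclmul u e = u ;
  unit_norm : aenorm e = aeone mu }.

(* Maps on L^\infty(Omega, X) are represented by maps on all classes of
   sections, of which only the restriction to [LinfX L] is ever used. *)
Record is_markov (L : set sec) (e : cl) (T : cl -> cl) : Prop := IsMarkov {
  markov_LinfX : forall u, LinfX L u -> LinfX L (T u) ;
  markovD : forall u v, LinfX L u -> LinfX L v -> T (u + v) = T u + T v ;
  markovZ : forall f u, Linf f -> LinfX L u -> T (aemulf f u) = aemulf f (T u) ;
  markov_pos : forall y, LinfX L y -> exists2 z, LinfX L z &
    T (aeclmul y (aeclstar y)) = aeclmul z (aeclstar z) ;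
  markov1 : T e = e }.

Record is_state (L : set sec) (e : cl) (phi : cl -> fcl) : Prop := IsState {
  state_Linf : forall u, LinfX L u -> Linf (phi u) ;
  stateD : forall u v, LinfX L u -> LinfX L v -> phi (u + v) = phi u + phi v ;
  stateZ : forall f u, Linf f -> LinfX L u ->
    phi (aemulf f u) = aemulf f (phi u) ;
  state_pos : forall y, LinfX L y -> aele 0 (phi (aeclmul y (aeclstar y))) ;
  state1 : phi e = aeone mu }.

Definition Linf_uniquely_ergodic (L : set sec) (e : cl)
    (T : cl -> cl) (phi : cl -> fcl) : Prop :=
  forall x, LinfX L x ->
    LinfX_norm (n%:R^-1 *: (\sum_(0 <= k < n) iter k T x) - aemulf (phi x) e)
      @[n --> \oo] --> (0 : R).

(* The supremum is taken in [0, +oo], so that it is meaningful even before the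
   family is known to be bounded, and is 0 when [Omega] is empty. *)
Definition uniformly_uniquely_ergodic (L : set sec) (e : cl)
    (l : cl -> forall w, X w)
    (Tw : forall w, X w -> X w) (phiw : forall w, X w -> R[i]) : Prop :=
  forall x, LinfX L x ->
    maxe 0%E (ereal_sup (range (fun w =>
      (complex.Re `|n%:R^-1 *: (\sum_(0 <= k < n) iter k (Tw w) (l x w))
                    - phiw w (l x w) *: l e w|)%:E)))
      @[n --> \oo] --> (0%E : \bar R).

End Bundles.

(* Main.v *)
Require Import Defs.
From mathcomp Require Import all_boot all_order all_algebra complex.
From mathcomp Require Import all_classical all_reals all_analysis.
From mathcomp Require Import measurable_realfun.

Set Implicit Arguments.
Unset Strict Implicit.
Unset Printing Implicit Defensive.
Import Order.TTheory GRing.Theory Num.Theory numFieldNormedType.Exports.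
Local Open Scope classical_set_scope.
Local Open Scope ring_scope.

(** The function [y_n = n^-1 sum_(k < n) T^k x - phi(x) e] lies in
    L^oo(Omega, X), and since [l] intertwines [T] with [T_w] and [phi] with
    [phi_w], its lifting at [w] is the n-th fibrewise deviation. As
    [|l y_n w| = p |y_n| w] and [p] is isometric, every fibrewise deviation is
    bounded by the norm of [y_n], uniformly in [w]. Most of the work is to see
    that [y_n] is in L^oo(Omega, X): that this space consists of the bounded
    measurable sections and is an L^oo(Omega)-module. *)

(** * Complex-valued norms and limits *)

Section Complex.
Context {R : realType}.
Implicit Types z : R[i].

Lemma Re_normE z : (complex.Re `|z|)%:C%C = `|z|.
Proof. by apply: RRe_real; exact: normr_real. Qed.

Lemma Re_normrE (V : normedModType R[i]) (x : V) : (complex.Re `|x|)%:C%C = `|x|.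
Proof. by apply: RRe_real; exact: normr_real. Qed.

(** Norms live in [R[i]] while measurability concerns real functions, hence the real part. It is
    1-Lipschitz, so the reverse triangle inequality suffices. *)
Lemma cvg_Re_norm (V : normedModType R[i]) (f : nat -> V) (x : V) :
  f n @[n --> \oo] --> x ->
  complex.Re `|f n| @[n --> \oo] --> complex.Re `|x|.
Proof.
move=> fx; apply/cvgrPdist_lt => eps eps0.
have eps0' : 0 < eps%:C%C :> R[i] by rewrite ltcR.
move/cvgrPdist_lt: fx => /(_ _ eps0'); apply: filterS => n.
rewrite -ltcR; apply: le_lt_trans.
have -> : complex.Re `|x| - complex.Re `|f n| = complex.Re (`|x| - `|f n|).
  by case: `|x| => ? ?; case: `|f n|.
by apply: le_trans (normc_ge_Re _) _; exact: ler_dist_dist.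
Qed.

Lemma cvg_complex (f g : nat -> R) (a b : R) :
  f n @[n --> \oo] --> a -> g n @[n --> \oo] --> b ->
  ((f n +i* g n)%C : R[i]^o) @[n --> \oo] --> ((a +i* b)%C : R[i]^o).
Proof.
move=> fa gb; apply/cvgrPdist_lt => /= eps eps0.
(* Positivity in [R[i]] forces a zero imaginary part: [eps] is real, and each coordinate gets half
   of it. *)
have := eps0; rewrite ltcE/= => /andP[/eqP Im0 Re0].
have -> : eps = (complex.Re eps)%:C%C by rewrite [LHS]complexE Im0 mulr0 addr0.
have e2 : 0 < complex.Re eps / 2 by rewrite divr_gt0.
move/cvgrPdist_lt: fa => /(_ _ e2) fa; move/cvgrPdist_lt: gb => /(_ _ e2) gb.
apply: filterS2 fa gb => n fa gb.
have -> : (a +i* b)%C - (f n +i* g n)%C =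
    (a - f n)%:C%C + 'i%C * (b - g n)%:C%C :> R[i].
  by rewrite [LHS]complexE.
apply: le_lt_trans (ler_normD _ _) _; rewrite normrM.
have nR (x : R) : `|x%:C%C| = `|x|%:C%C :> R[i].
  by rewrite normc_def/= expr0n addr0 sqrtr_sqr.
rewrite !nR normc_def/= expr0n expr1n add0r sqrtr1 mul1r.
by rewrite -rmorphD ltcR (splitr (complex.Re eps)) ltrD.
Qed.

End Complex.

(** * Measurability for a complete measure *)

Section AeMeasurable.
Context d (Omega : measurableType d) (R : realType).
Variable mu : {measure set Omega -> \bar R}.
Hypothesis mu_complete : measure_is_complete mu.

(** By completeness negligible sets are measurable, so changes on them are harmless. This lets
    representatives be exchanged freely below. *)
Lemma ae_measurable (f g : Omega -> R) : {ae mu, forall w, f w = g w} ->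
  measurable_fun setT f -> measurable_fun setT g.
Proof.
move=> fg /measurable_EFinP mf; apply/measurable_EFinP.
apply: (ae_measurable_fun mu_complete) mf.
by apply: filterS fg => w fg _ /=; rewrite fg.
Qed.

Lemma measurable_of_ae (P : Omega -> Prop) :
  {ae mu, forall w, P w} -> measurable [set w | P w].
Proof. by move=> /mu_complete /measurableC; rewrite setCK. Qed.

(** The convergence set [D] is conull, hence measurable by completeness. The limit is measurable on
    [D], and its extension by 0 agrees with [f] almost everywhere. *)
Lemma ae_measurable_cvg (h : nat -> Omega -> R) (f : Omega -> R) :
  (forall n, measurable_fun setT (h n)) ->
  {ae mu, forall w, h n w @[n --> \oo] --> f w} -> measurable_fun setT f.
Proof.
move=> mh hf; set D := [set w | h n w @[n --> \oo] --> f w].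
have mD : measurable D by exact: measurable_of_ae.
have /(measurable_restrictT _ mD) : measurable_fun D f.
  apply: (@measurable_fun_cvg _ _ _ D h) => // n.
  exact: measurable_funTS.
apply: ae_measurable.
by apply: filterS hf => w Dw; rewrite patchE mem_set.
Qed.

Definition complex_measurable (f : Omega -> R[i]) : Prop :=
  measurable_fun setT (fun w => complex.Re (f w)) /\
  measurable_fun setT (fun w => complex.Im (f w)).

Lemma cmeasurableE (u : aesec mu (scalar_fam R)) :
  cmeasurable u <-> complex_measurable (fun w => odflt 0 (u w)).
Proof.
have mu_dom : measurable (aedom u) by apply/measurable_of_ae/aeval_ae.
(* [h] stands for the real or the imaginary part. As [h 0 = 0], the default value off the domain
   matches the extension by 0 of the restriction. *)
have aux (h : R[i] -> R) : h 0 = 0 ->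
    measurable_fun (aedom u) (fun w => h (odflt 0 (u w))) <->
    measurable_fun setT (fun w => h (odflt 0 (u w))).
  move=> h0; rewrite measurable_restrictT//.
  set g := (X in _ <-> measurable_fun _ X).
  suff -> : g \_ (aedom u) = g by [].
  apply/funext => w; rewrite patchE; case: ifPn => //.
  rewrite notin_setE /aedom /g/=; case: (u w) => [a|]; last by rewrite /= h0.
  by move=> [].
by split=> -[mRe mIm]; split; apply/aux.
Qed.

End AeMeasurable.

(** * Pointwise values of classes *)

Section AeValues.
Context d (Omega : measurableType d) (R : realType).
Variable mu : {measure set Omega -> \bar R}.
Local Notation fcl := (aeclass mu (scalar_fam R)).

(* The value of a class at a point, 0 off the domain of the chosen
   representative: meaningful up to negligible sets only. *)
Definition aeat (V : Omega -> lmodType R[i]) (u : aeclass mu V) (w : Omega) : V w :=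
  odflt 0 (repr u w).

Lemma aeat_cl (V : Omega -> lmodType R[i]) (u : aesec mu V) :
  {ae mu, forall w, aeat (aecl u) w = odflt 0 (u w)}.
Proof. by apply: filterS (repr_aecl u) => w; rewrite /aeat => ->. Qed.

Lemma aeatD (V : Omega -> lmodType R[i]) (u v : aeclass mu V) :
  {ae mu, forall w, aeat (u + v) w = aeat u w + aeat v w}.
Proof.
apply: filterS3 (aeat_cl (aemap2 (fun w (x y : V w) => x + y) (repr u) (repr v)))
  (aeval_ae (repr u)) (aeval_ae (repr v)) => w.
by rewrite /aeat => ->/=; case: (repr u w) => // ?; case: (repr v w).
Qed.

Lemma aeatZ (V : Omega -> lmodType R[i]) (a : R[i]) (u : aeclass mu V) :
  {ae mu, forall w, aeat (a *: u) w = a *: aeat u w}.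
Proof.
apply: filterS (aeat_cl (aemap (fun w (x : V w) => a *: x) (repr u))) => w.
by rewrite /aeat => ->/=; case: (repr u w) => //=; rewrite scaler0.
Qed.

Lemma aeat_mulf (V : Omega -> lmodType R[i]) (f : fcl) (u : aeclass mu V) :
  {ae mu, forall w, aeat (aemulf f u) w = (aeat f w : R[i]) *: aeat u w}.
Proof.
apply: filterS3 (aeat_cl (aemap2 (U := scalar_fam R)
    (fun w (a : R[i]) (x : V w) => a *: x) (repr f) (repr u)))
  (aeval_ae (repr f)) (aeval_ae (repr u)) => w.
by rewrite /aeat => ->/=; case: (repr f w) => // ?; case: (repr u w).
Qed.

Lemma aeat_norm (V : Omega -> normedModType R[i]) (u : aeclass mu V) :
  {ae mu, forall w, aeat (aenorm u) w = `|aeat u w|}.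
Proof.
apply: filterS (aeat_cl (aemap (W := scalar_fam R)
  (fun w (x : V w) => `|x|) (repr u))) => w.
by rewrite /aeat => ->/=; case: (repr u w) => //=; rewrite normr0.
Qed.

(** Both representatives are defined almost everywhere, so the default 0 cannot identify distinct
    classes. *)
Lemma aeat_inj (V : Omega -> lmodType R[i]) (u v : aeclass mu V) :
  {ae mu, forall w, aeat u w = aeat v w} -> u = v.
Proof.
move=> uv; rewrite -[u]aeclK -[v]aeclK; apply/aeclP.
apply: filterS3 uv (aeval_ae (repr u)) (aeval_ae (repr v)) => w.
by rewrite /aeat; case: (repr u w) => // ?; case: (repr v w) => //= ? ->.
Qed.

Lemma aeat_const (a : R[i]) :
  {ae mu, forall w, (aeat (a *: aeone mu) w : R[i]) = a}.
Proof.
have one : {ae mu, forall w, (aeat (aeone mu) w : R[i]) = 1} by exact: aeat_cl.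
apply: filterS2 (aeatZ a (aeone mu)) one => w -> /= ->.
exact: mulr1.
Qed.

(** Embeds the complex scalars into L^oo as constants, so that complex homogeneity follows from
    L^oo-homogeneity. *)
Lemma aemulf_const (V : Omega -> lmodType R[i]) (a : R[i]) (u : aeclass mu V) :
  aemulf (a *: aeone mu) u = a *: u.
Proof.
apply: aeat_inj.
apply: filterS3 (aeat_mulf (a *: aeone mu) u) (aeatZ a u) (aeat_const a).
by move=> w -> -> ->.
Qed.

Definition ae_bounded (V : Omega -> normedModType R[i]) (u : aeclass mu V) :=
  exists2 a : R, 0 < a & {ae mu, forall w, `|aeat u w| <= a%:C%C}.

Lemma aele_norm_const (V : Omega -> normedModType R[i]) (u : aeclass mu V) (a : R) :
  aele (aenorm u) (a%:C%C *: aeone mu) <->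
  {ae mu, forall w, `|aeat u w| <= a%:C%C}.
Proof.
split; rewrite /aele; apply: filterS3 (aeat_norm u) (aeat_const a%:C%C) => w; rewrite /aeat.
  by move=> -> ->.
by move=> -> ->.
Qed.

End AeValues.

(** * Approximation by complex simple functions *)

Section SimpleFunctions.
Context d (Omega : measurableType d) (R : realType).
Implicit Types f g : Omega -> R[i].

(** The sets may overlap. The inductive form reduces closure under sums and scalar multiples to
    structural induction. *)
Inductive simple_function : (Omega -> R[i]) -> Prop :=
| SimpleFun0 : simple_function (fun=> 0)
| SimpleFunD A a f : measurable A -> simple_function f ->
    simple_function (fun w => a * \1_A w + f w).

Lemma simple_functionD f g :
  simple_function f -> simple_function g -> simple_function (f \+ g).
Proof.
move=> + sg; elim=> [|A a h mA _ IH].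
  by congr simple_function: sg; apply/funext => w /=; rewrite add0r.
congr simple_function: (SimpleFunD a mA IH).
by apply/funext => w /=; rewrite addrA.
Qed.

Lemma simple_functionZ (a : R[i]) f :
  simple_function f -> simple_function (fun w => a * f w).
Proof.
elim=> [|A b h mA _ IH].
  by congr simple_function: SimpleFun0; apply/funext => w; rewrite mulr0.
congr simple_function: (SimpleFunD (a * b) mA IH).
by apply/funext => w /=; rewrite mulrDr mulrA.
Qed.

Import HBSimple.

Lemma simple_function_sfun (f : {sfun Omega >-> R}) :
  simple_function (fun w => (f w)%:C%C).
Proof.
(* [f] is the sum, over its finite range, of each value times the indicator of its fibre. *)
under eq_fun do rewrite fimfunE fsbig_finite//= rmorph_sum/=.
elim: (finmap.enum_fset _) => [|y r IH].
  under eq_fun do rewrite big_nil; exact: SimpleFun0.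
under eq_fun do rewrite big_cons rmorphM/=.
have mA : measurable (f @^-1` [set y]) by [].
congr simple_function: (SimpleFunD y%:C%C mA IH).
by apply/funext => w /=; rewrite !indicE; case: (_ \in _).
Qed.

Lemma complex_measurable_approximation f : complex_measurable f ->
  exists2 s : nat -> Omega -> R[i], (forall n, simple_function (s n)) &
    forall w, (s n w : R[i]^o) @[n --> \oo] --> (f w : R[i]^o).
Proof.
move=> [/measurable_EFinP mRe /measurable_EFinP mIm].
have [g gRe] := approximation_sfun measurableT mRe.
have [h hIm] := approximation_sfun measurableT mIm.
exists (fun n w => (g n w)%:C%C + 'i%C * (h n w)%:C%C).
  move=> n; apply: simple_functionD; last apply: simple_functionZ;
  exact: simple_function_sfun.
move=> w.
(* The approximation converges in the extended reals; as the limit is finite, it also converges in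
   [R]. *)
have gw : g n w @[n --> \oo] --> complex.Re (f w) by exact: fine_cvg (gRe w I).
have hw : h n w @[n --> \oo] --> complex.Im (f w) by exact: fine_cvg (hIm w I).
have -> : f w = (complex.Re (f w) +i* complex.Im (f w))%C by case: (f w).
rewrite (_ : (fun n => _) = (fun n => (g n w +i* h n w)%C : R[i]^o)).
  exact: cvg_complex gw hw.
by apply/funext => n; rewrite [RHS]complexE.
Qed.

End SimpleFunctions.

(** * Measurable and bounded sections *)

Section MeasurableSections.
Context d (Omega : measurableType d) (R : realType).
Variable mu : {measure set Omega -> \bar R}.
Hypothesis mu_complete : measure_is_complete mu.
Variables (X : Omega -> cstarAlgType R) (L : set (aesec mu X)).
Hypothesis XL : is_bundle L.
Local Notation fcl := (aeclass mu (scalar_fam R)).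
Local Notation cl := (aeclass mu X).

(** Everywhere defined versions of simple sections: a member of [L] contributes 0 off its domain. *)
Inductive simple : (forall w, X w) -> Prop :=
| Simple0 : simple (fun=> 0)
| SimpleD A c s : measurable A -> L c -> simple s ->
    simple (fun w => (\1_A w : R[i]) *: odflt 0 (c w) + s w).

Lemma simple_sectionP (s : aesec mu X) : simple_section L s <->
  exists2 g, simple g & {ae mu, forall w, s w = Some (g w)}.
Proof.
split.
  move=> [n [A [c [Ac sE]]]].
  exists (fun w => \sum_(i < n) (\1_(A i) w : R[i]) *: odflt 0 (c i w)) => //.
  elim: n A c Ac {sE} => [|n IH] A c Ac.
    congr simple: Simple0.
    by apply/functional_extensionality_dep => w; rewrite big_ord0.
  congr simple: (SimpleD (Ac ord0).1 (Ac ord0).2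
    (IH (A \o lift ord0) (c \o lift ord0) (fun i => Ac (lift ord0 i)))).
  by apply/functional_extensionality_dep => w; rewrite big_ord_recl.
move=> [g sg sE].
suff [n [A [c [Ac gE]]]] : exists (n : nat) (A : 'I_n -> set Omega)
    (c : 'I_n -> aesec mu X), (forall i, measurable (A i) /\ L (c i)) /\
    forall w, g w = \sum_(i < n) (\1_(A i) w : R[i]) *: odflt 0 (c i w).
  exists n, A, c; split => //.
  by apply: filterS sE => w ->; rewrite gE.
elim: sg => [|A c h mA Lc _ [n [B [c' [Bc hE]]]]].
  have c : 'I_0 -> aesec mu X by case.
  by exists 0%N, (fun=> set0), c; split => [[]//|w]; rewrite big_ord0.
exists n.+1, (fun i => if unlift ord0 i is Some j then B j else A),
  (fun i => if unlift ord0 i is Some j then c' j else c); split.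
  by move=> i; case: unliftP.
move=> w; rewrite big_ord_recl unlift_none hE; congr (_ + _).
by apply: eq_bigr => i _; rewrite liftK.
Qed.

Lemma simpleD g h : simple g -> simple h -> simple (fun w => g w + h w).
Proof.
move=> + sh; elim=> [|A c s mA Lc _ IH].
  congr simple: sh.
  by apply/functional_extensionality_dep => w; rewrite add0r.
congr simple: (SimpleD mA Lc IH).
by apply/functional_extensionality_dep => w; rewrite addrA.
Qed.

Lemma simple_indicZ B (a : R[i]) g : measurable B -> simple g ->
  simple (fun w => (a * \1_B w) *: g w).
Proof.
move=> mB; elim=> [|A c s mA Lc _ IH].
  congr simple: Simple0.
  by apply/functional_extensionality_dep => w; rewrite scaler0.
(* The indicators of [A] and [B] multiply to that of the intersection, and [a *: c] is in [L] as the
   combination [a *: c + 0 *: c]. *)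
congr simple: (SimpleD (measurableI _ _ mA mB) (bundle_lin XL a 0 Lc Lc) IH).
apply/functional_extensionality_dep => w /=.
rewrite scalerDr; congr (_ + _).
case: (c w) => [x|] /=; last by rewrite !scaler0.
rewrite scale0r addr0 !scalerA indicI/=; congr (_ *: _).
by rewrite mulrC -[RHS]mulrA [X in _ = _ * X]mulrC.
Qed.

Lemma simpleZ (f : Omega -> R[i]) g :
  simple_function f -> simple g -> simple (fun w => f w *: g w).
Proof.
move=> + sg; elim=> [|A a h mA _ IH].
  congr simple: Simple0.
  by apply/functional_extensionality_dep => w; rewrite scale0r.
congr simple: (simpleD (simple_indicZ a mA sg) IH).
by apply/functional_extensionality_dep => w; rewrite scalerDl.
Qed.

Lemma measurable_norm_section (c : aesec mu X) : L c ->
  measurable_fun setT (fun w => complex.Re `|odflt 0 (c w)|).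
Proof.
move=> /(bundle_norm XL) /(cmeasurableE mu_complete)[+ _].
congr measurable_fun; apply/funext => w /=.
by case: (c w) => //=; rewrite normr0.
Qed.

Lemma measurable_norm_simple g : simple g ->
  measurable_fun setT (fun w => complex.Re `|g w|).
Proof.
(* Adding [\1_A *: c'] to [c + s] replaces [c] by [c + c'] on [A], and
   [c + c'] is again in [L]. *)
have aux s c : simple s -> L c ->
    measurable_fun setT (fun w => complex.Re `|odflt 0 (c w) + s w|).
  move=> ss; elim: ss c => [|A c' h mA Lc' _ IH] c Lc.
    by under eq_fun do rewrite addr0; exact: measurable_norm_section.
  have mAif : measurable_fun setT (fun w => w \in A).
    apply: (measurable_fun_bool true); rewrite setTI.
    by congr measurable: mA; apply/seteqP; split => w; [exact: mem_set|exact: set_mem].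
  have := measurable_fun_ifT mAif (IH _ (bundle_lin XL 1 1 Lc Lc')) (IH _ Lc).
  apply: (ae_measurable mu_complete).
  (* Off the domain of [c] or [c'] the sum in [L] takes the default 0 and the case split may fail,
     but only on a null set. *)
  apply: filterS2 (aeval_ae c) (aeval_ae c') => w.
  rewrite indicE /=; case: (w \in A); last by rewrite scale0r add0r.
  by case: (c w) => // x _; case: (c' w) => //= y _; rewrite !scale1r addrA.
case=> [|A c s mA Lc ss].
  by under eq_fun do rewrite normr0; exact: measurable_cst.
have s' := SimpleD mA Lc ss.
(* To drop the leading term of [aux], take [0 *: c + 0 *: c]: it is in [L] and its value is 0
   everywhere, by default off the domain. *)
have := aux _ _ s' (bundle_lin XL 0 0 Lc Lc).
congr measurable_fun; apply/funext => w /=.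
by case: (c w) => [x|] /=; rewrite ?scale0r !add0r.
Qed.

(** Each approximant is replaced by an everywhere defined simple section; the countably many
    exceptional null sets have a null union. *)
Lemma L0XP (u : cl) : L0X L u <->
  exists2 s : nat -> forall w, X w, (forall n, simple (s n)) &
    {ae mu, forall w, s n w @[n --> \oo] --> aeat u w}.
Proof.
split.
  move=> [v [s ss sv] <-].
  have /choice[g gP] : forall n, exists g, simple g /\ {ae mu, forall w, s n w = Some (g w)}.
    by move=> n; have [g ? ?] := (simple_sectionP (s n)).1 (ss n); exists g.
  exists g; first by move=> n; have [] := gP n.
  have gE : {ae mu, forall w, forall n, s n w = Some (g n w)}.
    by apply/ae_foralln => n; have [] := gP n.
  apply: filterS3 sv (aeat_cl v) gE => w + -> sE.
  by under eq_fun do rewrite sE/=.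
move=> [g sg gu]; exists (repr u); last exact: aeclK.
exists (fun n => aetotal mu (g n)); last exact: gu.
by move=> n; apply/simple_sectionP; exists (g n) => //; exact: aeW.
Qed.

Lemma L0E (f : fcl) : L0 f <-> complex_measurable (aeat f : Omega -> R[i]).
Proof.
split => [[u /(cmeasurableE mu_complete) [mRe mIm] <-]|mf].
  split; [apply: (ae_measurable mu_complete) mRe|
          apply: (ae_measurable mu_complete) mIm];
  by apply: filterS (aeat_cl u) => w ->.
by exists (repr f); [exact/(cmeasurableE mu_complete)|exact: aeclK].
Qed.

(** Norms of simple sections are measurable and converge almost everywhere to the norm of the
    limit. *)
Lemma L0_norm (u : cl) : L0X L u -> L0 (aenorm u).
Proof.
move=> /L0XP[s ss su]; apply/L0E; split.
  have : measurable_fun setT (fun w => complex.Re `|aeat u w|).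
    apply: (ae_measurable_cvg mu_complete (fun n => measurable_norm_simple (ss n))).
    by apply: filterS su => w; exact: cvg_Re_norm.
  by apply: (ae_measurable mu_complete); apply: filterS (aeat_norm u) => w ->.
apply: (ae_measurable mu_complete (f := fun=> 0)) => //.
by apply: filterS (aeat_norm u) => w ->; rewrite -Re_normrE.
Qed.

Lemma LinfE (f : fcl) : Linf f <->
  complex_measurable (aeat f : Omega -> R[i]) /\ ae_bounded f.
Proof.
by split=> -[/L0E mf [a a0 /aele_norm_const fa]]; split => //; exists a.
Qed.

(** [L0_norm] supplies the measurability of the norm, so only the bound remains to be checked. *)
Lemma LinfXE (u : cl) : LinfX L u <-> L0X L u /\ ae_bounded u.
Proof.
split=> -[Lu ub]; split => //.
  move/LinfE : ub => -[_ [a a0 ua]]; exists a => //.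
  by apply: filterS2 ua (aeat_norm u) => w + e; rewrite -[`|aeat u w|]normr_id -e.
apply/LinfE; split; first exact/L0E/L0_norm.
case: ub => a a0 ua; exists a => //.
apply: filterS2 ua (aeat_norm u) => w + e.
by rewrite -[X in X <= _ -> _]normr_id -e.
Qed.

Lemma LinfXD (u v : cl) : LinfX L u -> LinfX L v -> LinfX L (u + v).
Proof.
move=> /LinfXE[/L0XP[s ss su] [a a0 ua]] /LinfXE[/L0XP[t st tv] [b b0 vb]].
apply/LinfXE; split.
  apply/L0XP; exists (fun n w => s n w + t n w).
    by move=> n; exact: simpleD.
  by apply: filterS3 su tv (aeatD u v) => w sw tw ->; exact: cvgD.
exists (a + b); first exact: addr_gt0.
apply: filterS3 ua vb (aeatD u v) => w ua vb ->.
by rewrite rmorphD (le_trans (ler_normD _ _))// lerD.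
Qed.

(** Approximants are multiplied termwise: a simple function times a simple section is simple. The
    bounds multiply as well. *)
Lemma LinfX_mulf (f : fcl) (u : cl) :
  Linf f -> LinfX L u -> LinfX L (aemulf f u).
Proof.
move=> /LinfE[mf [a a0 fa]] /LinfXE[/L0XP[t st tu] [b b0 ub]].
have [s ss sf] := complex_measurable_approximation mf.
apply/LinfXE; split.
  apply/L0XP; exists (fun n w => s n w *: t n w).
    by move=> n; exact: simpleZ.
  by apply: filterS2 tu (aeat_mulf f u) => w tu ->; apply: cvgZ => //; exact: sf.
exists (a * b); first exact: mulr_gt0.
apply: filterS3 fa ub (aeat_mulf f u) => w fa ub ->.
by rewrite rmorphM normrZ ler_pM.
Qed.

Lemma Linf_const (a : R[i]) : Linf (a *: aeone mu).
Proof.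
apply/LinfE; split.
  split; [apply: (ae_measurable mu_complete (f := cst (complex.Re a)))|
    apply: (ae_measurable mu_complete (f := cst (complex.Im a)))] => //;
  by apply: filterS (aeat_const mu a) => w ->.
(* The added 1 keeps the bound strictly positive when [a] is 0. *)
exists (complex.Re `|a| + 1).
  by rewrite ltr_wpDl// -lecR Re_normE; exact: normr_ge0.
apply: filterS (aeat_const mu a) => w ->.
by rewrite rmorphD/= Re_normE lerDl.
Qed.

End MeasurableSections.

(** * Norm bound and linearity of the lifting *)

Lemma le_cLinf_norm d (Omega : measurableType d) (R : realType)
    (mu : {measure set Omega -> \bar R}) (f : Omega -> R[i]) w :
  cLinf mu f -> complex.Re `|f w| <= cLinf_norm f.
Proof.
(* The bound [M] ensures that the real [sup] is a true supremum. *)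
move=> [_ [M fM]]; apply: ub_le_sup; last by exists w.
by exists M => _ [v _ <-] /=; rewrite -lecR Re_normE; exact: fM.
Qed.

Section Lifting.
Context d (Omega : measurableType d) (R : realType).
Variable mu : {measure set Omega -> \bar R}.
Hypothesis mu_complete : measure_is_complete mu.
Variables (X : Omega -> cstarAlgType R) (L : set (aesec mu X)).
Hypothesis XL : is_bundle L.
Variables (p : aeclass mu (scalar_fam R) -> Omega -> R[i])
  (l : aeclass mu X -> forall w, X w).
Hypotheses (p_lift : is_lifting p) (l_lift : is_vlifting L p l).
Implicit Types u v : aeclass mu X.

(** Here an essential bound becomes a bound at every point, with no exceptional set. *)
Lemma norm_vlift_le u w : LinfX L u -> complex.Re `|l u w| <= LinfX_norm u.
Proof.
move=> Lu; have [_ nu] := Lu.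
rewrite /LinfX_norm -(lift_norm p_lift nu).
apply: le_trans (le_cLinf_norm w (lift_cLinf p_lift nu)).
by rewrite -(vlift_norm l_lift w Lu) normr_id.
Qed.

Lemma LinfXZ (a : R[i]) u : LinfX L u -> LinfX L (a *: u).
Proof. by rewrite -aemulf_const; apply/LinfX_mulf/Linf_const. Qed.

(** The scalar enters as a constant function, whose lifting is the same constant because [p] is
    linear and unital. *)
Lemma vlift_scale (a : R[i]) u w : LinfX L u -> l (a *: u) w = a *: l u w.
Proof.
move=> Lu; have L1 : Linf (aeone mu).
  by rewrite -[aeone mu]scale1r; exact: Linf_const.
rewrite -aemulf_const (vliftZ l_lift)//; last exact: Linf_const.
by rewrite (liftZ p_lift)// (lift1 p_lift) mulr1.
Qed.

Lemma LinfX_iter (T : aeclass mu X -> aeclass mu X) k u :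
  (forall v, LinfX L v -> LinfX L (T v)) -> LinfX L u -> LinfX L (iter k T u).
Proof. by move=> LT Lu; elim: k => //= k; exact: LT. Qed.

(** Both claims go through one induction, since additivity of [l] requires the partial sums to be in
    L^oo(Omega, X). *)
Lemma LinfX_vlift_sum (F : nat -> aeclass mu X) n w :
  (forall k, LinfX L (F k)) ->
  LinfX L (\sum_(0 <= k < n) F k) /\
  l (\sum_(0 <= k < n) F k) w = \sum_(0 <= k < n) l (F k) w.
Proof.
move=> LF; elim: n => [|n [IHL IHl]].
  (* Writing the zero class as a multiple of [F 0] places it in the space and gives it lifting 0. *)
  rewrite !big_nil -(scale0r (F 0%N)); split; first exact: LinfXZ.
  by rewrite vlift_scale// scale0r.
rewrite !big_nat_recr//=; split; first exact: LinfXD.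
by rewrite (vliftD l_lift)// IHl.
Qed.

End Lifting.

(** * Passage from the module to the fibres *)

Theorem theorem5p10 (R : realType) (d : measure_display)
    (Omega : measurableType d) (lam : {finite_measure set Omega -> \bar R})
    (lam_complete : measure_is_complete lam)
    (X : Omega -> cstarAlgType R) (L : set (aesec lam X))
    (XL : is_bundle L)
    (p : aeclass lam (scalar_fam R) -> Omega -> R[i])
    (p_lift : is_lifting p)
    (l : aeclass lam X -> forall w, X w) (l_lift : is_vlifting L p l)
    (e : aeclass lam X) (e_unit : is_L0X_unit L e)
    (T : aeclass lam X -> aeclass lam X) (T_markov : is_markov L e T)
    (phi : aeclass lam X -> aeclass lam (scalar_fam R))
    (phi_state : is_state L e phi)
    (Tw : forall w, {linear X w -> X w})
    (Tw_cont : forall w, continuous (Tw w))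
    (TwE : forall w x, LinfX L x -> Tw w (l x w) = l (T x) w)
    (phiw : forall w, {linear X w -> R[i]^o})
    (phiw_cont : forall w, continuous (phiw w))
    (phiwE : forall w x, LinfX L x -> phiw w (l x w) = p (phi x) w) :
  Linf_uniquely_ergodic L e T phi ->
  uniformly_uniquely_ergodic L e l (fun w => Tw w) (fun w => phiw w).
Proof.
move=> erg x Lx.
have Le : LinfX L e.
  split; first exact: unit_L0X e_unit.
  by rewrite (unit_norm e_unit) -[aeone _]scale1r; exact: Linf_const.
have Lit k : LinfX L (iter k T x) by apply: LinfX_iter => //; exact: (markov_LinfX T_markov).
have Lphi : Linf (phi x) by exact: (state_Linf phi_state).
(* [Tw w] is known on lifted values only; the orbit of [l x w] stays among them. *)
have Twit w k : iter k (Tw w) (l x w) = l (iter k T x) w.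
  by elim: k => //= k ->; rewrite TwE.
pose y n := n%:R^-1 *: (\sum_(0 <= k < n) iter k T x) - aemulf (phi x) e.
have yP n w : LinfX L (y n) /\ l (y n) w =
    n%:R^-1 *: (\sum_(0 <= k < n) iter k (Tw w) (l x w)) - phiw w (l x w) *: l e w.
  have [LS lS] := LinfX_vlift_sum lam_complete XL p_lift l_lift n w Lit.
  have Lpe : LinfX L (aemulf (phi x) e) by exact: LinfX_mulf.
  (* The opposite becomes a multiple by -1, so that additivity and homogeneity of [l] cover the
     difference. *)
  rewrite /y -[- aemulf _ _]scaleN1r; split.
    by apply: LinfXD => //; exact: LinfXZ.
  rewrite (vliftD l_lift); [|exact: LinfXZ..].
  rewrite !(vlift_scale lam_complete p_lift l_lift)// lS.
  rewrite (vliftZ l_lift)// scaleN1r phiwE//.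
  by under eq_bigr do rewrite -Twit.
(* The absolute value makes the majorant nonnegative, as the [maxe 0] in the goal requires, without
   inspecting the infimum behind [LinfX_norm]. *)
have y0 : `|LinfX_norm (y n)|%:E @[n --> \oo] --> 0%:E.
  apply: cvg_EFin; first exact: nearW.
  by rewrite -(normr0 R); apply: cvg_norm; exact: erg.
apply: (squeeze_cvge _ (cvg_cst 0%E) y0); apply: nearW => n /=.
rewrite le_max lexx/= ge_max lee_fin normr_ge0/=.
apply: ge_ereal_sup => _ [w _ <-]; have [Ly <-] := yP n w.
rewrite lee_fin (le_trans _ (ler_norm _))//.
exact: (norm_vlift_le p_lift l_lift).
Qed.
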